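(* Let $X$ be a real two-dimensional GL-space. Then $X$ is isometric either to $\mathbb{R}^2$ equipped with a norm whose unit ball is a parallelogram, or to the space $\tilde E$, where $\tilde E$ is $\mathbb{R}^2$ equipped with the norm $\|(a_1,a_2)\|=\max\{|a_2|,\ |a_1|+\tfrac12|a_2|\}$.
   Context: All spaces are real. $B_X$ and $S_X$ denote the closed unit ball and unit sphere of a normed space $X$, and $X^*$ its dual. For a non-empty $A\subset X$, $\rho(x,A)=\inf_{a\in A}\|x-a\|$. A Banach space $X$ is a GL-space (generalized-lush) if for every $x\in S_X$ and every $\varepsilon>0$ there is $x^*\in S_{X^*}$ such that, with $S=\{u\in B_X: x^*(u)\ge 1-\varepsilon\}$, one has $x\in S$ and $\rho(y,S)+\rho(-y,S)<2+\varepsilon$ for all $y\in S_X$. ''Isometric'' means that there is a linear surjective isometry. *)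

(* Defs.v *)
From HB Require Import structures.
From mathcomp Require Import all_boot all_order all_algebra.
From mathcomp Require Import all_classical all_reals all_analysis.
From mathcomp Require Import ring lra.

Set Implicit Arguments.
Unset Strict Implicit.
Unset Printing Implicit Defensive.

Import Order.TTheory GRing.Theory Num.Theory.
Import numFieldNormedType.Exports.

Local Open Scope classical_set_scope.
Local Open Scope ring_scope.

Section NormedSpaces.
Context {R : realType}.
Implicit Types X Y : normedModType R.

Definition unit_ball X : set X := [set x | `|x| <= 1].
Arguments unit_ball X : clear implicits.

Definition unit_sphere X : set X := [set x | `|x| = 1].
Arguments unit_sphere X : clear implicits.

Definition dual_norm X (f : {linear X -> R^o}) : R :=
  sup [set `|f x| | x in unit_ball X].

(* [sup] is 0 on sets that are not bounded above, so [dual_norm] is meaningful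
   only together with continuity. *)
Definition dual_sphere X : set {linear X -> R^o} :=
  [set f : {linear X -> R^o} | continuous (f : X -> R^o) /\ dual_norm f = 1].

Definition rho X (x : X) (A : set X) : R := inf [set `|x - a| | a in A].

Definition slice X (f : {linear X -> R^o}) (eps : R) : set X :=
  [set u | unit_ball X u /\ f u >= 1 - eps].

Definition GL_space (X : completeNormedModType R) : Prop :=
  forall (x : X) (eps : R), unit_sphere X x -> 0 < eps ->
  exists f : {linear X -> R^o},
    [/\ dual_sphere f, slice f eps x &
        forall y : X, unit_sphere X y ->
          rho y (slice f eps) + rho (- y) (slice f eps) < 2 + eps].

Definition has_dim X (n : nat) : Prop :=
  exists e : 'I_n -> X,
    forall x : X, exists! c : 'rV[R]_n, x = \sum_(i < n) c 0 i *: e i.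

Definition isometric X Y : Prop :=
  exists f : {linear X -> Y},
    (forall x, `|f x| = `|x|) /\ (forall y, exists x, f x = y).

End NormedSpaces.

Arguments unit_ball {R} X.
Arguments unit_sphere {R} X.

Record plane_norm (R : realType) := PlaneNorm {
  plane_norm_fun :> 'rV[R]_2 -> R;
  plane_normD : forall u v,
    plane_norm_fun (u + v) <= plane_norm_fun u + plane_norm_fun v;
  plane_normZ : forall (a : R) v,
    plane_norm_fun (a *: v) = `|a| * plane_norm_fun v;
  plane_norm_eq0 : forall v, plane_norm_fun v = 0 -> v = 0
}.

(* The alias keeps the norm [N] apart from the sup norm that the library puts
   on ['rV[R]_2]; only the vector space structure is inherited. *)
Definition normed_plane (R : realType) (N : plane_norm R) : Type := 'rV[R]_2.

HB.instance Definition _ (R : realType) (N : plane_norm R) :=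
  GRing.Lmodule.copy (normed_plane N) 'rV[R]_2.

HB.instance Definition _ (R : realType) (N : plane_norm R) :=
  Lmodule_isNormed.Build R (normed_plane N)
    (@plane_normD R N) (@plane_normZ R N) (@plane_norm_eq0 R N).

Definition parallelogram (R : realType) (A : set 'rV[R]_2) : Prop :=
  exists p u v : 'rV[R]_2, row_free (col_mx u v) /\
    A = [set w | exists s t : R,
          [/\ 0 <= s <= 1, 0 <= t <= 1 & w = p + s *: u + t *: v]].

Section Etilde.
Context (R : realType).

Definition Etilde_fun (a : 'rV[R]_2) : R :=
  Num.max `|a 0 1| (`|a 0 0| + 2^-1 * `|a 0 1|).

Lemma Etilde_funD u v : Etilde_fun (u + v) <= Etilde_fun u + Etilde_fun v.
Proof.
rewrite /Etilde_fun !mxE.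
have h0 := ler_normD (u 0 0) (v 0 0); have h1 := ler_normD (u 0 1) (v 0 1).
have a1 : forall x y : R, x <= Num.max x y by move=> x y; rewrite le_max lexx.
have a2 : forall x y : R, y <= Num.max x y.
  by move=> x y; rewrite le_max lexx orbT.
have := a1 `|u 0 1| (`|u 0 0| + 2^-1 * `|u 0 1|).
have := a2 `|u 0 1| (`|u 0 0| + 2^-1 * `|u 0 1|).
have := a1 `|v 0 1| (`|v 0 0| + 2^-1 * `|v 0 1|).
have := a2 `|v 0 1| (`|v 0 0| + 2^-1 * `|v 0 1|).
rewrite ge_max => ? ? ? ?; apply/andP; split; lra.
Qed.

Lemma Etilde_funZ (a : R) v : Etilde_fun (a *: v) = `|a| * Etilde_fun v.
Proof.
by rewrite /Etilde_fun !mxE !normrM maxr_pMr// mulrDr (mulrCA 2^-1).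
Qed.

Lemma Etilde_fun_eq0 v : Etilde_fun v = 0 -> v = 0.
Proof.
rewrite /Etilde_fun => v0.
have : Num.max `|v 0 1| (`|v 0 0| + 2^-1 * `|v 0 1|) <= 0 by rewrite v0.
rewrite ge_max => /andP[]; rewrite normr_le0 => /eqP v1.
rewrite v1 normr0 mulr0 addr0 normr_le0 => /eqP v00.
apply/rowP => i; rewrite mxE; case: i => -[|[|//]] ilt.
- by rewrite -[RHS]v00; congr (v 0 _); apply/val_inj.
- by rewrite -[RHS]v1; congr (v 0 _); apply/val_inj.
Qed.

Definition Etilde_norm : plane_norm R :=
  PlaneNorm Etilde_funD Etilde_funZ Etilde_fun_eq0.

Definition Etilde : normedModType R := normed_plane Etilde_norm.

End Etilde.

(* Main.v *)
From HB Require Import structures.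
Require Import Defs.
From mathcomp Require Import all_boot all_order all_algebra.
From mathcomp Require Import all_classical all_reals all_analysis.
From mathcomp Require Import ring lra.

(** Letting the width of the slices in the definition of a GL-space tend to 0,
    one obtains, for each unit vector x, a norm-one functional f with f x = 1
    such that every unit vector y admits a, b in the face F = {f = 1} of the
    unit ball B with |y - a| + |y + b| <= 2 ([GL_support]).  As
    f (a - y) + f (b + y) = 2, the norms of a - y and b + y must equal the
    values of f, so both vectors lie in the cone over F.  In dimension two F is
    a segment, and y in ker f shows that its length is at least 1; let p and q
    be its endpoints.  Written in the basis (p, q), the condition on y
    says exactly that both coordinates of y are at most 1 in absolute value.
    Hence B is contained in the hexagon H with vertices p, q, q - p and their
    opposites, while it contains the segment [p, q]: this is what is called a
    hexagonal pair ([hexagonal_pair_of_face]).  Every point of the sphere lies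
    on the segment of some hexagonal pair.

    Fix such a pair (p, q); everything is governed by n = |q - p|, which lies
    between 1 and 2.  If n = 1 then q - p is in B, so B = H, which is a linear
    image of the unit ball of the space Etilde ([hexagon_norm]).  If n = 2,
    the segment [q, -p] lies on the sphere and B is the parallelogram with
    vertices p, q, -p, -q ([diamond_norm]).

    If 1 < n < 2, consider a hexagonal pair (p', q') whose segment contains
    (q - p) / n.  That -p and q satisfy the hexagonal bounds for (p', q'),
    and p', q' those for (p, q), forces the new segment to start at q and to end
    on the side [-p, q - p] of H, or to start at -p and to end on the side
    [q, q - p].  Up to exchanging p and q and passing to opposites, the pair is
    {q, b q - p} for some b > 0 ([off_parallelogram_and_hexagon]).  Then the
    segment from -p to b q - p lies on the sphere; the hexagonal pair through
    its midpoint lies on the same side of H, and q can satisfy its bounds only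
    if its segment reaches q - p, so n <= 1 ([third_face]), a contradiction. *)

Set Implicit Arguments.
Unset Strict Implicit.
Unset Printing Implicit Defensive.

Import Order.TTheory GRing.Theory Num.Theory.
Import numFieldNormedType.Exports.

Local Open Scope classical_set_scope.
Local Open Scope ring_scope.

(** * Linear combinations of two vectors *)

Section Combinations.
Context (R : realType) (X : normedModType R).
Implicit Types (p q u v x y z : X) (a b c d : R).

Definition comb p q a b := a *: p + b *: q.

Lemma combD p q a b c d :
  comb p q a b + comb p q c d = comb p q (a + c) (b + d).
Proof. by rewrite /comb !scalerDl addrACA. Qed.

Lemma combZ p q c a b : c *: comb p q a b = comb p q (c * a) (c * b).
Proof. by rewrite /comb scalerDr !scalerA. Qed.

Lemma combN p q a b : - comb p q a b = comb p q (- a) (- b).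
Proof. by rewrite /comb opprD !scaleNr. Qed.

Lemma combB p q a b c d :
  comb p q a b - comb p q c d = comb p q (a - c) (b - d).
Proof. by rewrite combN combD. Qed.

Lemma comb10 p q : comb p q 1 0 = p.
Proof. by rewrite /comb scale1r scale0r addr0. Qed.

Lemma comb01 p q : comb p q 0 1 = q.
Proof. by rewrite /comb scale1r scale0r add0r. Qed.

Lemma comb_comb p q a b c d s t :
  comb (comb p q a b) (comb p q c d) s t =
  comb p q (s * a + t * c) (s * b + t * d).
Proof. by rewrite [LHS]/comb !combZ combD. Qed.

Lemma linear_scale (f : {linear X -> R^o}) a u : f (a *: u) = a * f u.
Proof. exact: linearZ. Qed.

Lemma comb_swap p q a b : comb q p a b = comb p q b a.
Proof. exact: addrC. Qed.

Lemma linear_comb (f : {linear X -> R^o}) p q a b :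
  f (comb p q a b) = a * f p + b * f q.
Proof. by rewrite linearD !linearZ. Qed.

Lemma ler_norm_comb p q a b : `|comb p q a b| <= `|a| * `|p| + `|b| * `|q|.
Proof. by rewrite (le_trans (ler_normD _ _))// !normrZ. Qed.

Lemma comb_convex_le1 p q a b : `|p| <= 1 -> `|q| <= 1 -> 0 <= a -> 0 <= b ->
  `|comb p q a b| <= a + b.
Proof.
move=> p1 q1 a0 b0; apply: (le_trans (ler_norm_comb _ _ _ _)).
by rewrite !ger0_norm// lerD// ler_piMr.
Qed.

End Combinations.

(** * Functionals and planes *)

Section Planes.
Context (R : realType) (X : normedModType R).
Implicit Types (u x y z : X) (f : {linear X -> R^o}).

(** The supremum defining [dual_norm f] is 1, hence not the default value of
    [sup], so the set of the |f x| is bounded. *)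
Lemma dual_sphere_le f u : dual_sphere f -> `|f u| <= `|u|.
Proof.
case=> _ f1.
have sf : has_sup [set `|f x| | x in unit_ball X].
  apply: contrapT => /sup_out; rewrite -/(dual_norm f) f1 => /eqP.
  by rewrite oner_eq0.
have le1 v : `|v| <= 1 -> `|f v| <= 1.
  by move=> v1; rewrite -f1; apply: sup_upper_bound => //; exists v.
have [->|u0] := eqVneq u 0; first by rewrite linear0 !normr0.
have nu : 0 < `|u| by rewrite normr_gt0.
have := le1 (`|u|^-1 *: u); rewrite linear_scale normrZ normrM.
rewrite ger0_norm ?invr_ge0// mulVf ?gt_eqF// => /(_ (lexx _)).
by rewrite ler_pdivrMl// mulr1.
Qed.

Lemma rho_approx x (A : set X) e : A !=set0 -> 0 < e ->
  exists2 a, A a & `|x - a| < rho x A + e.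
Proof.
move=> [a0 Aa0] e0.
have hi : has_inf [set `|x - a| | a in A].
  by split; [exists `|x - a0|, a0|exists 0 => _ [a _ <-]].
by have [_ [a Aa <-] ?] := inf_adherent e0 hi; exists a.
Qed.

Lemma has_dim2_basis : has_dim X 2 -> exists e1 e2 : X,
  (forall u, exists a b, u = comb e1 e2 a b) /\
  (forall a b, comb e1 e2 a b = 0 -> a = 0 /\ b = 0).
Proof.
move=> [e he]; exists (e 0), (e 1).
have eE (c : 'rV[R]_2) :
    \sum_(i < 2) c 0 i *: e i = comb (e 0) (e 1) (c 0 0) (c 0 1).
  by rewrite big_ord_recl big_ord1 /comb; do 3!f_equal; apply/val_inj.
split=> [u|a b ab0].
  by have [c [-> _]] := he u; exists (c 0 0), (c 0 1).
have [c [_ uc]] := he 0.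
have c0 : c = 0 by apply: uc; rewrite big1// => i _; rewrite mxE scale0r.
have cab : c = \row_i (if i == 0 then a else b).
  by apply: uc; rewrite eE !mxE.
move: cab; rewrite c0 => /rowP cab.
by have := cab 0; have := cab 1; rewrite !mxE/=.
Qed.

Lemma exists_unit_vector : has_dim X 2 -> exists x : X, `|x| = 1.
Proof.
move=> /has_dim2_basis[e1 [e2 [_ free]]].
have e10 : e1 != 0.
  apply/eqP => e10; have [] := free 1 0; first by rewrite comb10.
  by move=> /eqP; rewrite oner_eq0.
exists (`|e1|^-1 *: e1).
by rewrite normrZ normfV normr_id mulVf// normr_eq0.
Qed.

(** In the plane, ker f is the line spanned by f(e2) e1 - f(e1) e2. *)
Lemma kernel_basis f x : has_dim X 2 -> f x != 0 -> exists z,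
  [/\ `|z| = 1, f z = 0 & forall u, exists b, u = comb x z (f u / f x) b].
Proof.
move=> /has_dim2_basis[e1 [e2 [sp free]]] fx.
pose z' := comb e1 e2 (f e2) (- f e1).
have fz' : f z' = 0 by rewrite linear_comb; ring.
have z'0 : z' != 0.
  apply/eqP => /free[f2 /eqP]; rewrite oppr_eq0 => /eqP f1.
  have [a [b xE]] := sp x; move/eqP: fx; apply.
  by rewrite xE linear_comb f1 f2; ring.
have nz : `|z'| != 0 by rewrite normr_eq0.
exists (`|z'|^-1 *: z'); split.
- by rewrite normrZ normfV normr_id mulVf.
- by rewrite linear_scale fz' mulr0.
- move=> u; have [a [b wE]] := sp (u - (f u / f x) *: x).
  have : f (u - (f u / f x) *: x) = 0.
    by rewrite linearB linear_scale divfK// subrr.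
  rewrite wE linear_comb => ab0.
  suff [k kE] : exists k, comb e1 e2 a b = k *: z'.
    exists (k * `|z'|).
    rewrite /comb scalerA -mulrA mulfV// mulr1 -kE -wE.
    by rewrite addrC subrK.
  rewrite /z'; have [f2|f2] := eqVneq (f e2) 0.
    have f1 : f e1 != 0.
      apply/eqP => f1; move/eqP: z'0; apply.
      by rewrite /z' f1 f2 /comb oppr0 !scale0r addr0.
    exists (- (b / f e1)); rewrite combZ f2 mulr0 mulrNN divfK//; congr comb.
    by move/eqP: ab0; rewrite f2 mulr0 addr0 mulf_eq0 (negPf f1) orbF => /eqP.
  exists (a / f e2); rewrite combZ divfK//; congr comb.
  apply: (mulIf f2); rewrite mulrN mulNr mulrAC divfK//.
  by apply/eqP; rewrite -addr_eq0 addrC ab0.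
Qed.

End Planes.

(** * The limit of the slices *)

(** All limits below are taken along one ultrafilter on the indices, so that
    every bounded sequence converges and no subsequences need be extracted. *)
Lemma ultra_cvg_bounded (R : realType) (U : set_system nat) (u : nat -> R)
    (M : R) :
  UltraFilter U -> (forall n, `|u n| <= M) -> exists l : R, u @ U --> l.
Proof.
move=> UU uM.
have UM : U (u @^-1` `[- M, M]).
  by apply: filterS filterT => n _; rewrite /= in_itv/= -ler_norml.
have [l [_ ul]] := @segment_compact R (- M) M (fmap u U) _ UM.
exists l => A Al.
have [//|UnA] := in_ultra_setVsetC (u @^-1` A) UU.
by have [x [/=]] := ul (~` A) A UnA Al.
Qed.

(** The condition of a GL-space on a slice of width e, with the two distances
    replaced by the distances to actual points of the slice; that costs a
    further 2 e.  For e = 0 the slice is the face of the ball on which f = 1. *)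
Definition GL_functional (R : realType) (X : normedModType R)
    (f : {linear X -> R^o}) (x : X) (e : R) :=
  [/\ forall u, `|f u| <= `|u|, 1 - e <= f x &
    forall y, `|y| = 1 -> exists a b, [/\ `|a| <= 1, `|b| <= 1,
      1 - e <= f a, 1 - e <= f b & `|y - a| + `|y + b| <= 2 + 3 * e]].

Section SupportingFunctional.
Context (R : realType) (X : completeNormedModType R).
Hypotheses (X_dim2 : has_dim X 2) (X_GL : GL_space X).
Implicit Types (u v x y z : X).

Lemma GL_approx x e : `|x| = 1 -> 0 < e ->
  exists f : {linear X -> R^o}, GL_functional f x e.
Proof.
move=> x1 e0; have [f [fS [xB fx] near]] := X_GL x1 e0.
exists f; split => //; first by move=> u; exact: dual_sphere_le.
move=> y y1.
have S0 : slice f e !=set0 by exists x.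
have [a [a1 fa] ya] := rho_approx y S0 e0.
have [b [b1 fb] yb] := rho_approx (- y) S0 e0.
exists a, b; split => //.
have := near y y1; rewrite -[in `|y + b|]normrN opprD; lra.
Qed.

(** The functionals of the GL condition already control the norm: x is a unit
    vector with f x >= 1/2, so |f u| <= |u| bounds the coordinate along x, and
    the triangle inequality bounds the one along a unit vector of ker f. *)
Lemma bounded_coordinates :
  exists e1 e2 (M : R), forall u, exists a b,
    [/\ u = comb e1 e2 a b, `|a| <= M * `|u| & `|b| <= M * `|u|].
Proof.
have [x x1] := exists_unit_vector X_dim2.
have [f [fle fx _]] := GL_approx x1 (ltac:(lra) : 0 < 2^-1 :> R).
have fx0 : 0 < f x by lra.
have [z [z1 _ sp]] := kernel_basis X_dim2 (lt0r_neq0 fx0).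
exists x, z, 3 => u; have [b ub] := sp u.
have ua : `|f u / f x| <= 2 * `|u|.
  rewrite normrM normfV (gtr0_norm fx0) ler_pdivrMr//.
  apply: (le_trans (fle u)); have := normr_ge0 u; nra.
exists (f u / f x), b; split => //; first by have := normr_ge0 u; lra.
have -> : `|b| = `|u - (f u / f x) *: x|.
  by rewrite {1}ub /comb addrC addKr normrZ z1 mulr1.
apply: (le_trans (ler_normB _ _)); rewrite normrZ x1; lra.
Qed.

Lemma ultra_cvg_ball (U : set_system nat) (v : nat -> X) :
  UltraFilter U -> (forall n, `|v n| <= 1) -> exists l : X, v @ U --> l.
Proof.
move=> UU v1; have [e1 [e2 [M hM]]] := bounded_coordinates.
have M0 n : M * `|v n| <= `|M|.
  by rewrite (le_trans (ler_norm _))// normrM normr_id ler_piMr.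
have /choice[a ha] : forall n, exists c : R * R,
    [/\ v n = comb e1 e2 c.1 c.2, `|c.1| <= `|M| & `|c.2| <= `|M|].
  move=> n; have [a [b [vE aM bM]]] := hM (v n).
  by exists (a, b); split => //=; exact: le_trans (M0 n).
have [l1 c1] : exists l : R, (fun n => (a n).1) @ U --> l.
  by apply: (@ultra_cvg_bounded _ _ _ `|M|) => // n; case: (ha n).
have [l2 c2] : exists l : R, (fun n => (a n).2) @ U --> l.
  by apply: (@ultra_cvg_bounded _ _ _ `|M|) => // n; case: (ha n).
exists (comb e1 e2 l1 l2).
have -> : v = (fun n => comb e1 e2 (a n).1 (a n).2).
  by apply/funext => n; case: (ha n).
by apply: cvgD; apply: cvgZr_tmp.
Qed.

Lemma GL_support x : `|x| = 1 ->
  exists f : {linear X -> R^o}, GL_functional f x 0.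
Proof.
move=> x1.
have /choice[F hF] : forall n, exists f : {linear X -> R^o},
    GL_functional f x (harmonic n).
  by move=> n; apply: GL_approx => //; exact: harmonic_gt0.
have [U [UU oU]] := @ultraFilterLemma nat \oo _.
have hU : (@harmonic R) @ U --> (0 : R).
  by apply: cvg_trans cvg_harmonic => A; exact: oU.
have h1U : (fun n => 1 - harmonic n) @ U --> (1 : R).
  by rewrite -[X in _ --> X]subr0; apply: cvgB => //; exact: cvg_cst.
have Fle n u : `|F n u| <= `|u| by case: (hF n).
have /choice[g hg] : forall u, exists l : R, (fun n => F n u) @ U --> l.
  by move=> u; apply: (@ultra_cvg_bounded _ _ _ `|u|).
have gl : linear (g : X -> R^o).
  move=> a u v; apply: (@cvg_unique _ (@Rhausdorff R) _ _ _ _ (hg _)) => /=.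
  have -> : (fun n => F n (a *: u + v)) = (fun n => a * F n u + F n v).
    by apply/funext => n; rewrite linearD linear_scale.
  by apply: cvgD => //; exact: cvgMl_tmp.
pose gL : {linear X -> R^o} :=
  HB.pack (g : X -> R^o) (GRing.isLinear.Build _ _ _ _ _ gl).
have gle u : `|gL u| <= `|u|.
  by apply: cvgr_to_le (cvg_norm (hg u)) _; exact: nearW.
(* The F n are uniformly Lipschitz, so the argument may vary with n. *)
have limF (a : nat -> X) l : a @ U --> l -> (fun n => F n (a n)) @ U --> g l.
  move=> al; have -> : (fun n => F n (a n)) =
      (fun n => F n (a n - l)) + (fun n => F n l).
    by apply/funext => n; rewrite fctE/= -[LHS](subrK (F n l)) -linearB.
  rewrite -[g l]add0r; apply: cvgD => //.
  have al0 : (fun n => `|a n - l|) @ U --> (0 : R).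
    rewrite -(@normr0 _ X) -(subrr l); apply: cvg_norm; apply: cvgB => //.
    exact: cvg_cst.
  have : (fun n => `|F n (a n - l)| : R) @ U --> (0 : R).
    apply: (squeeze_cvgr _ (cvg_cst 0) al0).
    by apply: nearW => n; rewrite normr_ge0 Fle.
  exact: (@norm_cvg0 R R^o).
have lim1 (a : nat -> X) l : a @ U --> l ->
    (forall n, 1 - harmonic n <= F n (a n)) -> 1 - 0 <= gL l.
  rewrite subr0 => al ge1.
  by apply: ler_cvg_to h1U (limF _ _ al) _; exact: nearW.
have norm1 (a : nat -> X) l :
    a @ U --> l -> (forall n, `|a n| <= 1) -> `|l| <= 1.
  by move=> al a1; apply: cvgr_to_le (cvg_norm al) _; exact: nearW.
exists gL; split => //.
  by apply: (lim1 (fun=> x)); [exact: cvg_cst|move=> n; case: (hF n)].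
move=> y y1.
have /choice[a /choice[b hab]] : forall n, exists a b, [/\ `|a| <= 1, `|b| <= 1,
      1 - harmonic n <= F n a, 1 - harmonic n <= F n b
      & `|y - a| + `|y + b| <= 2 + 3 * harmonic n].
  by move=> n; case: (hF n) => _ _; exact.
have a1 n : `|a n| <= 1 by case: (hab n).
have b1 n : `|b n| <= 1 by case: (hab n).
have [la ca] := ultra_cvg_ball UU a1; have [lb cb] := ultra_cvg_ball UU b1.
exists la, lb; split; [exact: norm1 ca a1|exact: norm1 cb b1| | |].
- by apply: (lim1 a) => // n; case: (hab n).
- by apply: (lim1 b) => // n; case: (hab n).
have cl : (fun n => `|y - a n| + `|y + b n|) @ U --> `|y - la| + `|y + lb|.
  apply: cvgD; apply: cvg_norm; [apply: cvgB|apply: cvgD] => //;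
  exact: cvg_cst.
have cr : (fun n => 2 + 3 * harmonic n) @ U --> (2 + 3 * 0 : R).
  by apply: cvgD; [exact: cvg_cst|exact: cvgMl_tmp].
by apply: ler_cvg_to cl cr _; apply: nearW => n; case: (hab n).
Qed.

End SupportingFunctional.

(** * Faces and hexagonal pairs *)

(** The last clause bounds the norm below by the gauge of the hexagon with
    vertices p, q, q - p and their opposites: the unit ball lies inside that
    hexagon and has [p, q] as a side. *)
Definition hexagonal_pair (R : realType) (X : normedModType R) (p q : X) :=
  [/\ `|p| <= 1, `|q| <= 1, forall u, exists a b, u = comb p q a b &
      forall a b, [/\ `|a| <= `|comb p q a b|, `|b| <= `|comb p q a b| &
                      `|a + b| <= `|comb p q a b|]].

Section Faces.
Context (R : realType) (X : normedModType R).
Implicit Types (u v x y z : X).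

(** A supremum is attained because the norm is 1-Lipschitz along the line. *)
Lemma last_point x z : `|x| <= 1 -> `|z| = 1 ->
  exists t : R,
    `|comb x z 1 t| <= 1 /\ forall s, `|comb x z 1 s| <= 1 -> s <= t.
Proof.
move=> x1 z1; pose T : set R := [set t | `|comb x z 1 t| <= 1].
have nb (s t : R) : `|comb x z 1 s| <= `|comb x z 1 t| + `|s - t|.
  have -> : comb x z 1 s = comb x z 1 t + (s - t) *: z.
    rewrite -[z in _ *: z](comb01 x z) combZ combD !(mulr0, mulr1) addr0.
    by rewrite subrKC.
  by rewrite (le_trans (ler_normD _ _))// normrZ z1 mulr1.
have sT : has_sup T.
  split; first by exists 0; rewrite /T/= comb10.
  exists 2 => t /= t1; apply: (le_trans (ler_norm _)).
  have -> : `|t| = `|comb x z 1 t - x|.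
    by rewrite /comb scale1r addrAC subrr add0r normrZ z1 mulr1.
  by rewrite (le_trans (ler_normB _ _))// -[leRHS]/(1 + 1) lerD.
exists (sup T); split; last by move=> s Ts; exact: sup_upper_bound.
apply/ler_addgt0Pr => e e0.
have [t Tt lt] := sup_adherent e0 sT.
apply: (le_trans (nb _ t)); apply: lerD => //.
by rewrite ger0_norm ?subr_ge0 ?sup_upper_bound//; lra.
Qed.

(** Let [x + t1 z, x + t2 z] be the face {f = 1}, with z a unit vector of
    ker f.  For a unit vector u, the condition yields a point a of the face with
    |a - u| = 1 - f u = f (a - u); so a - u lies in the cone over the face.
    Comparing z-coordinates of u = a - (a - u) gives exactly the two bounds on
    the coordinates of u with respect to the endpoints of the face. *)
Lemma hexagonal_pair_of_face x (f : {linear X -> R^o}) :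
  has_dim X 2 -> `|x| = 1 -> GL_functional f x 0 ->
  exists p q (l : R),
    [/\ hexagonal_pair p q, 0 <= l <= 1 & x = comb p q l (1 - l)].
Proof.
move=> dim2 x1 [fle fx0 near]; have lex1 : `|x| <= 1 by rewrite x1.
have face1 a : `|a| <= 1 -> 1 - 0 <= f a -> f a = 1.
  move=> a1; rewrite subr0 => fa; apply/eqP; rewrite eq_le fa andbT.
  by rewrite (le_trans (ler_norm _))// (le_trans (fle a)).
have fx := face1 _ lex1 fx0.
have [|z [z1 fz sp]] := @kernel_basis _ _ f x dim2.
  by rewrite fx oner_neq0.
have fE a b : f (comb x z a b) = a by rewrite linear_comb fx fz; ring.
have {}sp u : exists b, u = comb x z (f u) b.
  by have [b] := sp u; rewrite fx divr1; exists b.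
have [t2 [qle t2max]] := last_point lex1 z1.
have [t1' [ple t1min']] := last_point lex1 (etrans (normrN z) z1).
have flip a b : comb x (- z) a b = comb x z a (- b).
  by rewrite /comb scalerN scaleNr.
have {t1' ple t1min'} [t1 [ple t1min]] : exists t1 : R,
    `|comb x z 1 t1| <= 1 /\ forall s, `|comb x z 1 s| <= 1 -> t1 <= s.
  exists (- t1'); split => [|s s1]; first by rewrite -flip.
  by rewrite lerNl; apply: t1min'; rewrite flip opprK.
have cone r h : `|comb x z r h| <= r -> r * t1 <= h <= r * t2.
  move=> wr; have r0 : 0 <= r by exact: le_trans wr.
  have [r00|r0'] := eqVneq r 0.
    move: wr; rewrite r00 normr_le0 /comb scale0r add0r -normr_eq0 normrZ z1.
    by rewrite mulr1 normr_eq0 => /eqP ->; rewrite !mul0r lexx.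
  have rp : 0 < r by rewrite lt0r r0'.
  have w1 : `|comb x z 1 (h / r)| <= 1.
    have -> : comb x z 1 (h / r) = r^-1 *: comb x z r h.
      by rewrite combZ mulVf// mulrC.
    by rewrite normrZ ger0_norm ?invr_ge0// ler_pdivrMl// mulr1.
  rewrite mulrC -ler_pdivlMr// t1min//= mulrC -ler_pdivrMr//; exact: t2max.
have close u : `|u| = 1 -> exists a : R,
    [/\ t1 <= a <= t2 & `|comb x z 1 a - u| <= 1 - f u].
  move=> u1; have [a [b [a1 b1 fa fb]]] := near u u1.
  rewrite mulr0 addr0 => uab; have {}fb := face1 _ b1 fb.
  have [s aE] := sp a; rewrite (face1 _ a1 fa) in aE.
  exists s; rewrite -aE t1min -?aE//= t2max -?aE//; split => //.
  have := le_trans (ler_norm _) (fle (u + b)); rewrite linearD fb distrC; lra.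
(* Apply the condition to z itself: the face contains a and a - z. *)
have len : 1 <= t2 - t1.
  have [s [/andP[_ s2]]] := close z z1.
  rewrite fz -[X in _ - X](comb01 x z) combB !subr0 => s1.
  by have := t1min _ s1; lra.
have D0 : 0 < t2 - t1 by lra.
pose p := comb x z 1 t1; pose q := comb x z 1 t2.
have pqE a b : comb p q a b = comb x z (a + b) (a * t1 + b * t2).
  by rewrite comb_comb !mulr1.
have le1 a b : `|comb p q a b| = 1 -> a <= 1 /\ b <= 1.
  move=> u1; have [s [/andP[s1 s2]]] := close _ u1.
  rewrite pqE fE combB => /cone/andP[c1 c2].
  by split; rewrite -(ler_pM2r D0); lra.
have le_norm a b : a <= `|comb p q a b| /\ b <= `|comb p q a b|.
  have [u0|u0] := eqVneq `|comb p q a b| 0.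
    move: (u0); rewrite pqE => {}u0.
    have ab0 : a + b = 0.
      apply/eqP; rewrite -normr_le0.
      by have := fle (comb x z (a + b) (a * t1 + b * t2)); rewrite fE u0.
    have /cone/andP[c1 c2] : `|comb x z (a + b) (a * t1 + b * t2)| <= a + b.
      by rewrite u0 ab0.
    rewrite u0; suff : b = 0 by lra.
    by apply: (mulIf (lt0r_neq0 D0)); rewrite mul0r; nra.
  have up : 0 < `|comb p q a b| by rewrite lt0r u0 normr_ge0.
  have : `|comb p q (`|comb p q a b|^-1 * a) (`|comb p q a b|^-1 * b)| = 1.
    by rewrite -combZ normrZ normfV normr_id mulVf.
  by move=> /le1; rewrite !ler_pdivrMl// !mulr1.
exists p, q, (t2 / (t2 - t1)); split.
- split => //.
  + move=> u; have [h uE] := sp u.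
    exists ((f u * t2 - h) / (t2 - t1)), ((h - f u * t1) / (t2 - t1)).
    by rewrite pqE {1}uE; congr comb; field; rewrite gt_eqF.
  + move=> a b; have [a1 b1] := le_norm a b; have [a2 b2] := le_norm (- a) (- b).
    rewrite -combN normrN in a2 b2.
    split; [by rewrite ler_norml; lra|by rewrite ler_norml; lra|].
    by rewrite pqE -{1}(fE (a + b) (a * t1 + b * t2)).
- have h2 := t2max 0; have h1 := t1min 0; rewrite comb10 in h1 h2.
  have {}h1 := h1 lex1; have {}h2 := h2 lex1.
  by rewrite divr_ge0 ?ler_pdivrMr ?mul1r//; lra.
- rewrite pqE -[LHS](comb10 x z); congr comb; first by ring.
  by field; rewrite gt_eqF.
Qed.

End Faces.

(** * The two extreme norms *)

Section HexagonalPairs.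
Context (R : realType) (X : normedModType R).
Implicit Types (p q u x : X) (a b : R).

Lemma hexagonal_pair_swap p q : hexagonal_pair p q -> hexagonal_pair q p.
Proof.
case=> p1 q1 sp le; split => // [u|a b].
  by have [a [b ->]] := sp u; exists b, a; rewrite comb_swap.
by rewrite comb_swap addrC; case: (le b a).
Qed.

Lemma hexagonal_pair_inj p q a b c d : hexagonal_pair p q ->
  comb p q a b = comb p q c d -> a = c /\ b = d.
Proof.
case=> _ _ _ le /eqP; rewrite -subr_eq0 combB -normr_eq0 => /eqP e0.
have [] := le (a - c) (b - d); rewrite e0 !normr_le0 !subr_eq0.
by move=> /eqP-> /eqP->.
Qed.

Lemma hexagonal_pair_le1 p q a b : hexagonal_pair p q -> `|comb p q a b| <= 1 ->
  [/\ -1 <= a <= 1, -1 <= b <= 1 & -1 <= a + b <= 1].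
Proof.
case=> _ _ _ le u1; have [a1 b1 ab1] := le a b.
by rewrite -!ler_norml; split; exact: le_trans u1.
Qed.

(** As q - p has norm at most 1, all vertices of the hexagon are in the ball;
    each vector is a positive combination of two neighbouring vertices. *)
Lemma hexagon_norm p q a b : hexagonal_pair p q -> `|comb p q (-1) 1| <= 1 ->
  `|comb p q a b| = Num.max `|a + b| (Num.max `|a| `|b|).
Proof.
move=> [p1 q1 _ le] r1; apply/eqP; rewrite eq_le; apply/andP; split; last first.
  by case: (le a b) => *; rewrite !ge_max; apply/and3P.
have qr (c d : R) : 0 <= c -> 0 <= d -> `|comb p q (- c) (c + d)| <= c + d.
  move=> c0 d0; have -> : comb p q (- c) (c + d) = comb (comb p q (-1) 1) q c d.
    by rewrite -{3}(comb01 p q) comb_comb; congr comb; ring.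
  exact: comb_convex_le1.
have rp (c d : R) : 0 <= c -> 0 <= d -> `|comb p q (- (c + d)) c| <= c + d.
  move=> c0 d0.
  have -> : comb p q (- (c + d)) c = comb (comb p q (-1) 1) (- p) c d.
    by rewrite -{3}(comb10 p q) combN comb_comb; congr comb; ring.
  by apply: comb_convex_le1 => //; rewrite normrN.
have up (c d : R) : 0 <= d ->
   `|comb p q c d| <= Num.max `|c + d| (Num.max `|c| `|d|).
  move=> d0; have [c0|c0] := leP 0 c.
    rewrite le_max; apply/orP; left.
    rewrite [leRHS]ger0_norm ?addr_ge0//; exact: comb_convex_le1.
  rewrite !le_max; apply/orP; right; rewrite (ltr0_norm c0) (ger0_norm d0).
  have [cd|cd] := leP (- c) d; apply/orP; [right|left].
    have := qr (- c) (d + c); rewrite opprK.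
    by rewrite (_ : - c + (d + c) = d); [apply; lra|ring].
  have := rp d (- c - d).
  rewrite (_ : d + (- c - d) = - c); last by ring.
  by rewrite opprK; apply; lra.
have [b0|b0] := leP 0 b; first exact: up.
have := up (- a) (- b); rewrite -combN normrN -opprD !normrN; apply; lra.
Qed.

(** The right-hand side is |a| + |b|.  When a and b have opposite signs, the
    lower bound comes from writing a multiple of q - p as the difference of
    two vectors, one of them the given one and the other its mirror image. *)
Lemma diamond_norm p q a b : hexagonal_pair p q -> 2 <= `|comb p q (-1) 1| ->
  `|comb p q a b| = Num.max `|a + b| `|a - b|.
Proof.
move=> [p1 q1 _ le] r2; apply/eqP; rewrite eq_le; apply/andP; split.
  rewrite (le_trans (ler_norm_comb _ _ _ _))//.
  have : `|a| + `|b| <= Num.max `|a + b| `|a - b|.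
    rewrite le_max; have [a0|a0] := ger0P a; have [b0|b0] := ger0P b.
    - by apply/orP; left; rewrite [leRHS]ger0_norm; lra.
    - by apply/orP; right; rewrite [leRHS]ger0_norm; lra.
    - by apply/orP; right; rewrite [leRHS]ler0_norm; lra.
    - by apply/orP; left; rewrite [leRHS]ler0_norm; lra.
  by apply: le_trans; apply: lerD; rewrite ler_piMr.
rewrite ge_max; case: (le a b) => a1 b1 -> /=.
have opp (c d : R) : 0 <= c -> 0 <= d -> c + d <= `|comb p q (- c) d|.
  move=> c0 d0; have := ler_normB (comb p q (- c) d) (comb p q d (- c)).
  rewrite combB (_ : comb p q _ _ = (c + d) *: comb p q (-1) 1); last first.
    by rewrite combZ; congr comb; ring.
  rewrite normrZ [X in X * _]ger0_norm ?addr_ge0// => h.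
  have := ler_norm_comb p q d (- c).
  rewrite normrN (ger0_norm c0) (ger0_norm d0).
  nra.
have [a0|a0] := leP 0 a; have [b0|b0] := leP 0 b.
- rewrite (ger0_norm a0) in a1; rewrite (ger0_norm b0) in b1.
  by rewrite ler_norml; lra.
- have := opp a (- b); rewrite -combN normrN ger0_norm; lra.
- have := opp (- a) b; rewrite opprK ler0_norm; lra.
- rewrite (ltr0_norm a0) in a1; rewrite (ltr0_norm b0) in b1.
  by rewrite ler_norml; lra.
Qed.

Lemma isometric_of_pairs (Y : normedModType R) p q (v w : Y) :
  hexagonal_pair p q -> (forall y, exists a b, y = comb v w a b) ->
  (forall a b, `|comb v w a b| = `|comb p q a b|) -> isometric X Y.
Proof.
move=> pq vw eqn; have [_ _ sp _] := pq.
have /choice[C hC] : forall u, exists c : R * R, u = comb p q c.1 c.2.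
  by move=> u; have [a [b ->]] := sp u; exists (a, b).
have CE a b : C (comb p q a b) = (a, b).
  rewrite [LHS]surjective_pairing.
  by have [<- <-] := hexagonal_pair_inj pq (hC (comb p q a b)).
pose f u := comb v w (C u).1 (C u).2.
have fl : linear (f : X -> Y).
  move=> a u u'; have -> : a *: u + u' =
      comb p q (a * (C u).1 + (C u').1) (a * (C u).2 + (C u').2).
    by rewrite -combD -combZ -!hC.
  by rewrite /f CE combZ combD.
pose fL : {linear X -> Y} :=
  HB.pack (f : X -> Y) (GRing.isLinear.Build _ _ _ _ _ fl).
exists fL; split.
  by move=> u /=; rewrite /f eqn -hC.
by move=> y; have [a [b ->]] := vw y; exists (comb p q a b); rewrite /= /f CE.
Qed.

(** The vertices p, q and q - p are sent to the vertices (1/2, 1), (-1/2, 1)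
    and (-1, 0) of the ball of Etilde. *)
Lemma isometric_Etilde p q : hexagonal_pair p q -> `|comb p q (-1) 1| <= 1 ->
  isometric X (Etilde R).
Proof.
move=> pq r1.
pose v s : Etilde R := \row_i (if i == 0 then s / 2 else 1).
have vE s t (a b : R) : (comb (v s) (v t) a b : 'rV[R]_2) =
    \row_i (if i == 0 then (a * s + b * t) / 2 else a + b).
  by apply/rowP => i; rewrite !mxE; case: ifP => _; field.
apply: (@isometric_of_pairs _ p q (v 1) (v (-1))) => // [y|a b].
  exists (y 0 1 / 2 + y 0 0), (y 0 1 / 2 - y 0 0); rewrite vE.
  apply/rowP => i; rewrite !mxE; case: i => -[|[|//]] ilt /=.
    by rewrite (_ : Ordinal ilt = 0); [field|exact/val_inj].
  by rewrite (_ : Ordinal ilt = 1); [field|exact/val_inj].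
rewrite (hexagon_norm _ _ pq)// -[LHS]/(Etilde_fun _) vE /Etilde_fun !mxE/=.
congr Num.max; rewrite mulr1 mulrN1 normrM [`|2^-1|]ger0_norm ?invr_ge0//.
case: (leP `|a| `|b|); case: (ger0P a); case: (ger0P b);
  case: (ger0P (a - b)); case: (ger0P (a + b)) => *; lra.
Qed.

(** The vertices p and q are sent to (1, 1) and (1, -1), so that the diamond
    becomes the unit ball of the maximum norm. *)
Lemma isometric_parallelogram p q :
  hexagonal_pair p q -> 2 <= `|comb p q (-1) 1| ->
  exists N : plane_norm R,
     parallelogram (unit_ball (normed_plane N)) /\
     isometric X (normed_plane N).
Proof.
move=> pq r2.
pose F (v : 'rV[R]_2) : R := Num.max `|v 0 0| `|v 0 1|.
have FD (u v : 'rV[R]_2) : F (u + v) <= F u + F v.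
  rewrite /F !mxE ge_max; apply/andP; split; apply: (le_trans (ler_normD _ _));
  by apply: lerD; rewrite le_max lexx ?orbT.
have FZ (a : R) v : F (a *: v) = `|a| * F v.
  by rewrite /F !mxE !normrM maxr_pMr.
have eta (v : 'rV[R]_2) : v = \row_i (if i == 0 then v 0 0 else v 0 1).
  apply/rowP => i; rewrite mxE; case: i => -[|[|//]] ilt /=; congr (v 0 _);
  exact/val_inj.
have F0 v : F v = 0 -> v = 0.
  move=> v0; have : F v <= 0 by rewrite v0.
  rewrite ge_max !normr_le0 => /andP[/eqP v00 /eqP v01].
  by rewrite (eta v) v00 v01; apply/rowP => i; rewrite !mxE if_same.
pose N := PlaneNorm FD FZ F0; exists N.
pose w (s t : R) : 'rV[R]_2 := \row_i (if i == 0 then s else t).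
split.
  exists (w (-1) (-1)), (w 2 0), (w 0 2); split.
    apply/row_freeP.
    have -> : col_mx (w 2 0) (w 0 2) = 2%:M :> 'M[R]_2.
      apply/matrixP => i j; rewrite mxE.
      case: splitP => k; rewrite ord1 !mxE -!val_eqE /= => ->;
      by case: j => -[|[|//]].
    by exists (2^-1)%:M; rewrite -scalar_mxM divff.
  apply/seteqP; split => v.
    move=> v1; have {v1} : F v <= 1 by [].
    rewrite ge_max !ler_norml => /andP[/andP[? ?] /andP[? ?]].
    exists ((v 0 0 + 1) / 2), ((v 0 1 + 1) / 2); split; [lra|lra|].
    by rewrite [LHS]eta; apply/rowP => i; rewrite !mxE; case: ifP => _; field.
  move=> [s [t [s01 t01 ->]]]; rewrite /unit_ball/= -[leLHS]/(F _) /F !mxE/=.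
  rewrite ge_max !ler_norml; lra.
apply: (@isometric_of_pairs (normed_plane N : normedModType R) p q
  (w 1 1) (w 1 (-1))) => // [y|a b].
  exists ((y 0 0 + y 0 1) / 2), ((y 0 0 - y 0 1) / 2).
  by rewrite [LHS]eta; apply/rowP => i; rewrite !mxE; case: ifP => _; field.
by rewrite (diamond_norm _ _ pq)// -[LHS]/(F _) /F !mxE/= !mulr1 mulrN1.
Qed.

End HexagonalPairs.

(** * Between the parallelogram and the hexagon *)

(** Here p' = a (-p) + b q and q' = c (-p) + d q, and s, t, u, v are the entries
    of the inverse base change: -p = s p' + t q' and q = u p' + v q'.  The
    inequalities are among those expressing that p', q' satisfy the hexagonal
    bounds for (p, q), and -p, q those for (p', q'); the equations in l and n say
    that (q - p) / n = l p' + (1 - l) q'.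

    Let D be the determinant s v - u t, so that (a, b, c, d) =
    (v, -t, -u, s) / D.  If u t >= 0, then v <= D <= s v and s <= D <= s v
    force s = v = 1 and u t = 0, so q = q' or -p = p'.  If u t < 0, both D and
    1 / D = a d - b c turn out to be at most 1, the former strictly, which is
    absurd. *)
Lemma between_parallelogram_and_hexagon (R : realType)
    (a b c d s t u v l n : R) :
  a * s + b * u = 1 -> a * t + b * v = 0 ->
  c * s + d * u = 0 -> c * t + d * v = 1 ->
  a <= 1 -> b <= 1 -> a - b <= 1 -> c <= 1 -> d <= 1 -> d - c <= 1 ->
  s <= 1 -> s + t <= 1 -> v <= 1 -> u + v <= 1 ->
  s + u = n * l -> t + v = n * (1 - l) -> 0 <= l <= 1 -> 1 < n < 2 ->
  0 < s * v - u * t -> (a = 1 /\ 0 < b) \/ (d = 1 /\ 0 < c).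
Proof.
move=> E1 E2 E3 E4 a' b' ab' c' d' dc' s' st' v' uv' S1 S2.
move=> /andP[l0 l1] /andP[n1 n2]; set D := s * v - u * t => D0.
have aD : a * D = v.
  by rewrite -[RHS]mul1r -E1 -[LHS]addr0 -(mulr0 u) -E2 /D; ring.
have bD : b * D = - t.
  by rewrite -[RHS]mulr1 -E1 -[LHS]subr0 -(mulr0 s) -E2 /D; ring.
have cD : c * D = - u.
  by rewrite -[RHS]mulr1 -E4 -[LHS]subr0 -(mulr0 v) -E3 /D; ring.
have dD : d * D = s.
  by rewrite -[RHS]mulr1 -E4 -[LHS]addr0 -(mulr0 t) -E3 /D; ring.
have adbc : (a * d - b * c) * D = 1.
  have <- : (a * s + b * u) * (c * t + d * v) -
            (a * t + b * v) * (c * s + d * u) = 1.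
    by rewrite E1 E2 E3 E4; ring.
  by rewrite /D; ring.
have sumE : s + u + (t + v) = n by rewrite S1 S2; ring.
have s1 : 0 <= s + u by rewrite S1 mulr_ge0//; lra.
have s2 : 0 <= t + v by rewrite S2 mulr_ge0//; lra.
have vD : v <= D by rewrite -aD ler_piMl// ltW.
have sD : s <= D by rewrite -dD ler_piMl// ltW.
have uv0 : 0 < u + v by lra.
have st0 : 0 < s + t by lra.
have sgnD (x y : R) : x * D = y -> 0 < y -> 0 < x.
  by move=> <-; rewrite pmulr_lgt0.
have {S1 S2 l0 l1 E1 E2 E3 E4} DE : D = s * v - u * t by [].
have [ut_ge0|ut_lt0] := leP 0 (u * t).
  have sv_gt0 : 0 < s * v by lra.
  have v_gt0 : 0 < v.
    rewrite ltNge; apply/negP => v_le0.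
    have s_lt0 : s < 0.
      rewrite ltNge; apply/negP => s_ge0.
      by have := mulr_ge0_le0 s_ge0 v_le0; lra.
    have : - v * - s <= u * t by apply: ler_pM; lra.
    by rewrite mulrNN mulrC; lra.
  have s_gt0 : 0 < s by rewrite -(pmulr_lgt0 _ v_gt0).
  have sE : s = 1.
    suff : 1 * v <= s * v by rewrite ler_pM2r//; lra.
    by lra.
  have vE : v = 1.
    suff : s * 1 <= s * v by rewrite ler_pM2l//; lra.
    by lra.
  rewrite sE vE mulr1 in DE aD dD vD.
  have /eqP : u * t = 0 by lra.
  have D1 : D = 1 by lra.
  rewrite D1 !mulr1 in aD bD cD dD.
  by rewrite mulf_eq0 => /orP[] /eqP z; [left|right]; split; lra.
exfalso.
suff [D1 ad1] : D < 1 /\ a * d - b * c <= 1.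
  suff : (a * d - b * c) * D < 1 by rewrite adbc ltxx.
  by apply: le_lt_trans D1; rewrite ler_piMl// ltW.
have [u_gt0|u_le0] := ltP 0 u.
  have t_lt0 : t < 0 by rewrite -(pmulr_rlt0 _ u_gt0).
  have v_gt0 : 0 < v by lra.
  have s_gt0 : 0 < s by lra.
  have [a0 b0] : 0 < a /\ 0 < b.
    by split; [exact: sgnD aD _|apply: sgnD bD _; lra].
  have [c0 d0] : 0 < - c /\ 0 < d.
    by split; [apply: (@sgnD _ u) => //; lra|exact: sgnD dD _].
  split.
    have h1 : s * v <= v by rewrite ler_piMl// ltW.
    have h2 : u * - t < u by rewrite gtr_pMr//; lra.
    by lra.
  have h1 : a * d <= d by rewrite ler_piMl// ltW.
  have h2 : b * - c <= - c by rewrite ler_piMl// ltW.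
  by lra.
have u_lt0 : u < 0.
  rewrite lt_neqAle u_le0 andbT.
  by apply: contraTneq ut_lt0 => ->; rewrite mul0r ltxx.
have t_gt0 : 0 < t by rewrite -(nmulr_rlt0 _ u_lt0).
have v_gt0 : 0 < v by lra.
have s_gt0 : 0 < s by lra.
have [a0 b0] : 0 < a /\ 0 < - b.
  by split; [exact: sgnD aD _|apply: (@sgnD _ t) => //; lra].
have [c0 d0] : 0 < c /\ 0 < d.
  by split; [apply: sgnD cD _; lra|exact: sgnD dD _].
split.
  have h1 : s * v <= s by rewrite ler_piMr// ltW.
  have h2 : - u * t < t by rewrite gtr_pMl//; lra.
  by lra.
have h1 : a * d <= a by rewrite ler_piMr// ltW.
have h2 : - b * c <= - b by rewrite ler_piMr// ltW.
by lra.
Qed.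

Section AllFaces.
Context (R : realType) (X : normedModType R).
Implicit Types (p q u x : X) (a b : R).
Hypothesis faces : forall x, `|x| = 1 -> exists p q (l : R),
  [/\ hexagonal_pair p q, 0 <= l <= 1 & x = comb p q l (1 - l)].

(** The segment from -p to b q - p lies on the sphere, because it lies on a side
    of the hexagon.  Both endpoints have the maximal value 1 under the functional
    of the pair (p', q') through its midpoint, so p', q' lie on the same side
    -p + [0, 1] q.  Since q is a multiple of q' - p', the bounds for (p', q')
    require q' - p' to be at least as long as q: {p', q'} = {-p, q - p}. *)
Lemma third_face p q b : hexagonal_pair p q -> 0 < b ->
  `|comb p q (-1) b| <= 1 -> `|comb p q (-1) 1| <= 1.
Proof.
move=> pq b0 r1; have [p1 q1 sp le] := pq.
have Np1 : `|comb p q (-1) 0| <= 1 by rewrite -oppr0 -combN comb10 normrN.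
pose m := comb p q (-1) (b / 2).
have mE : m = comb (comb p q (-1) 0) (comb p q (-1) b) (1/2) (1/2).
  by rewrite comb_comb /m; congr comb; field.
have m1 : `|m| = 1.
  apply/eqP; rewrite eq_le; apply/andP; split; last first.
    by have [+ _ _] := le (-1) (b / 2); rewrite normrN1.
  by rewrite mE (le_trans (comb_convex_le1 _ _ _ _))//; lra.
have [p' [q' [l [pq' _ mE']]]] := faces m1.
have [p'1 q'1 sp' _] := pq'.
have [c1 [c2 cE]] := sp' (comb p q (-1) 0).
have [d1 [d2 dE]] := sp' (comb p q (-1) b).
have [e1 e2] : 1/2 * c1 + 1/2 * d1 = l /\ 1/2 * c2 + 1/2 * d2 = 1 - l.
  by apply: (hexagonal_pair_inj pq'); rewrite -mE' mE cE dE comb_comb.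
have [_ _ /andP[_ c12]] : [/\ -1 <= c1 <= 1, -1 <= c2 <= 1 & -1 <= c1 + c2 <= 1].
  by apply: (hexagonal_pair_le1 pq'); rewrite -cE.
have [_ _ /andP[_ d12]] : [/\ -1 <= d1 <= 1, -1 <= d2 <= 1 & -1 <= d1 + d2 <= 1].
  by apply: (hexagonal_pair_le1 pq'); rewrite -dE.
have [a1 [b1 p'E]] := sp p'; have [a2 [b2 q'E]] := sp q'.
have [ca cb] : -1 = c1 * a1 + c2 * a2 /\ 0 = c1 * b1 + c2 * b2.
  by apply: (hexagonal_pair_inj pq); rewrite cE {1}p'E {1}q'E comb_comb.
have [da db] : -1 = d1 * a1 + d2 * a2 /\ b = d1 * b1 + d2 * b2.
  by apply: (hexagonal_pair_inj pq); rewrite dE {1}p'E {1}q'E comb_comb.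
(* k is the coefficient in b q = k (q' - p'). *)
pose k := d2 - c2.
have c1E : c1 = 1 - c2 by lra.
have d1E : d1 = 1 - d2 by lra.
have ka : k * (a2 - a1) = 0.
  by rewrite -(subrr (-1)) {1}da ca c1E d1E /k; ring.
have kb : k * (b2 - b1) = b.
  by rewrite -[RHS]subr0 {1}db cb c1E d1E /k; ring.
have k0 : k != 0 by apply: contraTneq b0 => k0; rewrite -kb k0 mul0r ltxx.
have a12 : a2 = a1.
  by apply/eqP; rewrite -subr_eq0; move/eqP: ka; rewrite mulf_eq0 (negPf k0).
have a1E : a1 = -1 by rewrite ca a12 c1E; ring.
have [_ /andP[kb_ kb'] _] :
    [/\ -1 <= - k / b <= 1, -1 <= k / b <= 1 & -1 <= - k / b + k / b <= 1].
  apply: (hexagonal_pair_le1 pq').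
  suff -> : comb p' q' (- k / b) (k / b) = q by [].
  rewrite -[RHS](comb01 p q) p'E q'E comb_comb a12; congr comb.
    by field; rewrite gt_eqF.
  by rewrite -[RHS](divff (lt0r_neq0 b0)) -{3}kb; field; rewrite gt_eqF.
rewrite ler_pdivlMr// ler_pdivrMr// in kb_ kb'.
have {}kb_ : -b <= k by lra.
move: (p'1) (q'1); rewrite p'E q'E a12 a1E.
move=> /(hexagonal_pair_le1 pq)[_ /andP[_ b1'] /andP[ab1 _]].
move=> /(hexagonal_pair_le1 pq)[_ /andP[_ b2'] /andP[ab2 _]].
have [k_gt0|k_le0] := ltP 0 k.
  have b_gt : 0 < b2 - b1 by rewrite -(pmulr_rgt0 _ k_gt0) kb.
  have b2E : b2 = 1.
    suff : b * 1 <= b * (b2 - b1) by rewrite ler_pM2l//; lra.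
    by rewrite mulr1 -{1}kb ler_wpM2r//; lra.
  by move: q'1; rewrite q'E a12 a1E b2E.
have k_lt0 : k < 0 by rewrite lt_neqAle k0.
have b_lt : b2 - b1 < 0 by rewrite -(nmulr_rgt0 _ k_lt0) kb.
have b1E : b1 = 1.
  suff : b * 1 <= b * (b1 - b2) by rewrite ler_pM2l//; lra.
  have -> : b * 1 = - k * (b1 - b2) by rewrite mulr1 -{1}kb; ring.
  by rewrite ler_wpM2r; lra.
by move: p'1; rewrite p'E a1E b1E.
Qed.

(** The two signs of the determinant correspond to the two ways of naming the
    endpoints of the segment through (q - p) / n. *)
Lemma off_parallelogram_and_hexagon p q : hexagonal_pair p q ->
  1 < `|comb p q (-1) 1| < 2 -> exists b, 0 < b /\
    (`|comb p q (-1) b| <= 1 \/ `|comb q p (-1) b| <= 1).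
Proof.
move=> pq; have [p1 q1 sp _] := pq; set n := `|_| => n12.
have n_gt0 : 0 < n by lra.
pose x := n^-1 *: comb p q (-1) 1.
have x1 : `|x| = 1 by rewrite normrZ normfV normr_id mulVf// gt_eqF.
have [p' [q' [l [pq' l01 xE]]]] := faces x1.
have [p'1 q'1 sp' _] := pq'.
have [s [t stE]] := sp' (- p); have [u [v uvE]] := sp' q.
have [a' [b p'E]] := sp p'; have [c' [d q'E]] := sp q'.
pose a := - a'; pose c := - c'.
have {}p'E : p' = comb (- p) q a b by rewrite /comb scalerN scaleNr opprK.
have {}q'E : q' = comb (- p) q c d by rewrite /comb scalerN scaleNr opprK.
clearbody a c.
have NcombE (e f : R) : comb (- p) q e f = comb p q (- e) f.
  by rewrite /comb scalerN scaleNr.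
have [E1 E2] : 1 = a * s + b * u /\ 0 = a * t + b * v.
  by apply: (hexagonal_pair_inj pq'); rewrite comb10 {1}p'E stE {1}uvE comb_comb.
have [E3 E4] : 0 = c * s + d * u /\ 1 = c * t + d * v.
  by apply: (hexagonal_pair_inj pq'); rewrite comb01 {1}q'E stE {1}uvE comb_comb.
have [S1 S2] : s + u = n * l /\ t + v = n * (1 - l).
  apply: (hexagonal_pair_inj pq'); rewrite -combZ -xE scalerA divff ?gt_eqF//.
  by rewrite scale1r -combD -stE -uvE /comb scaleN1r scale1r.
have p'E' : `|comb p q (- a) b| <= 1 by rewrite -NcombE -p'E.
have q'E' : `|comb p q (- c) d| <= 1 by rewrite -NcombE -q'E.
have stE' : `|comb p' q' s t| <= 1 by rewrite -stE normrN.
have uvE' : `|comb p' q' u v| <= 1 by rewrite -uvE.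
have [/andP[a1 _] /andP[_ b1] /andP[ab1 ba1]] := hexagonal_pair_le1 pq p'E'.
have [/andP[c1 _] /andP[_ d1] /andP[cd1 dc1]] := hexagonal_pair_le1 pq q'E'.
have [/andP[_ s1] /andP[_ t1] /andP[_ st1]] := hexagonal_pair_le1 pq' stE'.
have [/andP[_ u1] /andP[_ v1] /andP[_ uv1]] := hexagonal_pair_le1 pq' uvE'.
have third e f : `|comb p q (- e) f| <= 1 ->
    (e = 1 /\ 0 < f) \/ (f = 1 /\ 0 < e) -> exists b0, 0 < b0 /\
    (`|comb p q (-1) b0| <= 1 \/ `|comb q p (-1) b0| <= 1).
  move=> + [[e1 f0]|[f1 e0]]; first by rewrite e1 => ?; exists f; split; [|left].
  by rewrite f1 -normrN combN opprK comb_swap => ?; exists e; split; [|right].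
have {}p'E' := third _ _ p'E'; have {}q'E' := third _ _ q'E'.
clear stE uvE p'E q'E stE' uvE' xE x1 NcombE third.
have [D0|D0|D0] := ltgtP (s * v - u * t) 0.
- suff [cd|ba] : (c = 1 /\ 0 < d) \/ (b = 1 /\ 0 < a).
    by apply: q'E'; left.
    by apply: p'E'; right.
  apply: (@between_parallelogram_and_hexagon _ c d a b t s v u (1 - l) n); lra.
- suff [ab|dc] : (a = 1 /\ 0 < b) \/ (d = 1 /\ 0 < c).
    by apply: p'E'; left.
    by apply: q'E'; right.
  apply: (@between_parallelogram_and_hexagon _ a b c d s t u v l n); lra.
- have : (a * d - b * c) * (s * v - u * t) = 1.
    have <- : (a * s + b * u) * (c * t + d * v) -
              (a * t + b * v) * (c * s + d * u) = 1.
      by rewrite -E1 -E2 -E3 -E4; ring.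
    by ring.
  by rewrite D0 mulr0 => /eqP; rewrite eq_sym oner_eq0.
Qed.

End AllFaces.

Theorem theorem2p10 (R : realType) (X : completeNormedModType R)
    (X_dim2 : has_dim X 2) (X_GL : GL_space X) :
  (exists N : plane_norm R,
     parallelogram (unit_ball (normed_plane N)) /\
     isometric X (normed_plane N)) \/
  isometric X (Etilde R).
Proof.
have faces (x : X) : `|x| = 1 -> exists p q (l : R),
    [/\ hexagonal_pair p q, 0 <= l <= 1 & x = comb p q l (1 - l)].
  move=> x1; have [f fx] := GL_support X_dim2 X_GL x1.
  exact: hexagonal_pair_of_face X_dim2 x1 fx.
have [x x1] := exists_unit_vector X_dim2.
have [p [q [_ [pq _ _]]]] := faces x x1.
have [r1|r1] := leP `|comb p q (-1) 1| 1.
  by right; exact: isometric_Etilde pq r1.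
have [r2|r2] := leP 2 `|comb p q (-1) 1|.
  by left; exact: isometric_parallelogram pq r2.
suff : `|comb p q (-1) 1| <= 1 by rewrite leNgt r1.
have [|b [b0 [h|h]]] := off_parallelogram_and_hexagon faces pq.
- by rewrite r1.
- exact: third_face faces _ _ _ pq b0 h.
- have := third_face faces (hexagonal_pair_swap pq) b0 h.
  by rewrite comb_swap -normrN combN opprK.
Qed.
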